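(* Let $\mu$ be a non-atomic Borel probability measure on $[0,1]$. For all $x\in[0,1]$ and $z\in\mathbb{R}$, $$c_{\mu,\lambda}(z,x)\,c_{\lambda,\mu}(z,x)+s_{\lambda,\mu}(z,x)\,s_{\mu,\lambda}(z,x)=1.$$
   Context: Functions $p_n,q_n$: for $x\in[0,1]$ put $p_0(x)=q_0(x)=1$ and, for $n\in\mathbb{N}=\{1,2,\dots\}$: for odd $n$, $p_n(x)=\int_0^x p_{n-1}(t)\,d\mu(t)$ and $q_n(x)=\int_0^x q_{n-1}(t)\,dt$; for even $n$, $p_n(x)=\int_0^x p_{n-1}(t)\,dt$ and $q_n(x)=\int_0^x q_{n-1}(t)\,d\mu(t)$. For $z\in\mathbb{R}$, $x\in[0,1]$ (absolutely convergent series; the index $\lambda$ denotes Lebesgue measure): $s_{\mu,\lambda}(z,x)=\sum_{n\ge0}(-1)^n z^{2n+1}p_{2n+1}(x)$, $s_{\lambda,\mu}(z,x)=\sum_{n\ge0}(-1)^n z^{2n+1}q_{2n+1}(x)$, $c_{\lambda,\mu}(z,x)=\sum_{n\ge0}(-1)^n z^{2n}p_{2n}(x)$, $c_{\mu,\lambda}(z,x)=\sum_{n\ge0}(-1)^n z^{2n}q_{2n}(x)$. *)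

(* Defs.v *)
From HB Require Import structures.
From mathcomp Require Import all_boot all_order all_algebra.
From mathcomp Require Import all_classical all_reals all_analysis.

Set Implicit Arguments.
Unset Strict Implicit.
Unset Printing Implicit Defensive.

Import Order.TTheory GRing.Theory Num.Theory.
Import numFieldNormedType.Exports.

Local Open Scope classical_set_scope.
Local Open Scope ring_scope.

Definition is_atom (d : measure_display) (T : measurableType d) (R : realType)
    (mu : {measure set T -> \bar R}) (A : set T) : Prop :=
  [/\ measurable A, (0 < mu A)%E &
    forall B : set T, measurable B -> B `<=` A -> mu B = 0%E \/ mu B = mu A].

Definition non_atomic (d : measure_display) (T : measurableType d)
    (R : realType) (mu : {measure set T -> \bar R}) : Prop :=
  forall A : set T, ~ is_atom mu A.

Section measure_trigonometric_functions.
Context (R : realType) (mu : {measure set (measurableTypeR R) -> \bar R}).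

(* Only the values at x in [0, 1] are meaningful. *)
Fixpoint p (n : nat) : R -> R :=
  if n is m.+1 then
    if odd n then fun x => \int[mu]_(t in `[0, x]) p m t
    else fun x => \int[@lebesgue_measure R]_(t in `[0, x]) p m t
  else fun=> 1.

Fixpoint q (n : nat) : R -> R :=
  if n is m.+1 then
    if odd n then fun x => \int[@lebesgue_measure R]_(t in `[0, x]) q m t
    else fun x => \int[mu]_(t in `[0, x]) q m t
  else fun=> 1.

Definition s_mu_lambda (z x : R) : R :=
  limn (series (fun n => (-1) ^+ n * z ^+ (2 * n + 1) * p (2 * n + 1) x)).

Definition s_lambda_mu (z x : R) : R :=
  limn (series (fun n => (-1) ^+ n * z ^+ (2 * n + 1) * q (2 * n + 1) x)).

Definition c_lambda_mu (z x : R) : R :=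
  limn (series (fun n => (-1) ^+ n * z ^+ (2 * n) * p (2 * n) x)).

Definition c_mu_lambda (z x : R) : R :=
  limn (series (fun n => (-1) ^+ n * z ^+ (2 * n) * q (2 * n) x)).

End measure_trigonometric_functions.

(* Main.v *)
(* Integration by parts turns the product of two successive iterated integrals
   into a sum of two mixed integrals, so that the alternating sum of the
   products q_k p_(2n - k), for k = 0, ..., 2n, telescopes to 0 when n >= 1.  Up
   to the factor (-1)^n z^(2n), this sum is the coefficient of order n in the
   Cauchy products of the two pairs of series, which therefore add up to their
   constant term 1.  Integration by parts is Tonelli's theorem on a triangle; in
   each use one of the two measures is Lebesgue measure, so that the diagonal
   is negligible.  The bound q_(2n), p_(2n) <= L^(-n) exp(L x), valid for every
   L > 0, gives absolute convergence for every z. *)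
Require Import Defs.
From mathcomp Require Import all_boot all_order all_algebra.
From mathcomp Require Import all_classical all_reals all_analysis.
From mathcomp Require Import measurable_realfun ring lra zify.

Set Implicit Arguments.
Unset Strict Implicit.
Unset Printing Implicit Defensive.

Import Order.TTheory GRing.Theory Num.Theory.
Import numFieldNormedType.Exports.

Local Open Scope classical_set_scope.
Local Open Scope ring_scope.

(** * Cauchy products of absolutely convergent series *)

Definition cauchy_prod (R : pzSemiRingType) (a b : nat -> R) (n : nat) : R :=
  \sum_(i < n.+1) a i * b (n - i)%N.

(** Raising n by one adds the antidiagonal i + j = n of the triangle, that is, one entry to each
    row. *)
Lemma series_cauchy_prod (R : pzRingType) (a b : nat -> R) (n : nat) :
  \sum_(0 <= k < n) cauchy_prod a b k =
  \sum_(0 <= i < n) a i * (\sum_(0 <= j < n - i) b j).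
Proof.
elim: n => [|n IH]; first by rewrite !big_nil.
rewrite big_nat_recr//= IH [RHS]big_nat_recr//= subSnn big_nat1.
rewrite /cauchy_prod big_ord_recr/= subnn addrA; congr (_ + _).
rewrite -(big_mkord xpredT (fun i => a i * b (n - i)%N)) -big_split/=.
apply: eq_big_nat => i /andP[_ ilt].
by rewrite subSn 1?ltnW// big_nat_recr//= mulrDr.
Qed.

(* The difference between the product of the partial sums and the partial sum
   of the Cauchy product is dominated by the same difference for the series of
   absolute values, hence by [A n * B n - A (n %/ 2) * B (n %/ 2)]. *)
Lemma cvg_series_cauchy_prod (R : realType) (a b : R^nat) :
  cvgn [normed series a] -> cvgn [normed series b] ->
  series (cauchy_prod a b) @ \oo --> limn (series a) * limn (series b).
Proof.
move=> na nb.
set A := [normed series a]; set B := [normed series b].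
have AB : (A \* B) @ \oo --> limn A * limn B by exact: cvgM.
have AB2 : ((A \* B) \o divn^~ 2) @ \oo --> limn A * limn B.
  by apply: cvg_comp AB; exact: cvg_divnr.
have ab : (series a \* series b) @ \oo --> limn (series a) * limn (series b).
  by apply: cvgM; exact: normed_cvg.
rewrite -[X in _ --> X]subr0.
rewrite (_ : series (cauchy_prod a b) = (series a \* series b) \-
   (series a \* series b \- series (cauchy_prod a b))); last first.
  by apply/funext => n /=; rewrite opprB addrC subrK.
apply: cvgB => //.
apply: norm_cvg0.
apply: (@squeeze_cvgr _ _ _ _ (cst 0)
  ((A \* B) \- ((A \* B) \o divn^~ 2))); last 2 first.
- exact: cvg_cst.
- by rewrite -(subrr (limn A * limn B)); exact: cvgB.
near=> n; rewrite normr_ge0/=.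
rewrite {1 2 3}/series/= series_cauchy_prod mulr_suml -sumrB.
have -> : A n * B n = \sum_(0 <= i < n) `|a i| * B n by rewrite mulr_suml.
have HB m : B m = \sum_(0 <= i < m) `|b i| by [].
have Bmono m k : (m <= k)%N -> B m <= B k.
  move=> mk; rewrite !HB [leRHS](big_cat_nat (leq0n m) mk)//= lerDl.
  by apply: sumr_ge0.
rewrite lerBrDr.
apply: (@le_trans _ _ (\sum_(0 <= i < n) `|a i| * (B n - B (n - i)%N) +
   \sum_(0 <= i < n) `|a i| * B (n - i)%N)); last first.
  rewrite -big_split/= le_eqVlt; apply/orP; left; apply/eqP.
  by apply: eq_bigr => i _; rewrite -mulrDr subrK.
apply: lerD.
  apply: le_trans (ler_norm_sum _ _ _) _.
  apply: ler_sum_nat => i /andP[_ ilt]; rewrite -mulrBr normrM ler_wpM2l//.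
  rewrite !HB (big_cat_nat (leq0n _) (leq_subr i n))//=.
  rewrite [X in _ <= X - _](big_cat_nat (leq0n _) (leq_subr i n))//=.
  by rewrite [X in `|X|]addrC addKr [leRHS]addrC addKr; exact: ler_norm_sum.
(* For i < n / 2 the index n - i is at least n / 2, so [B (n - i)] is at least [B (n %/ 2)]; the
   remaining terms are nonnegative and dropped. *)
have hn : (n %/ 2 <= n)%N by lia.
rewrite [leRHS](big_cat_nat (leq0n _) hn)//= -[leLHS]addr0 lerD//; last first.
  by apply: sumr_ge0 => i _; rewrite mulr_ge0// HB sumr_ge0.
rewrite {1}/A/= mulr_suml; apply: ler_sum_nat => i /andP[_ ilt].
by rewrite ler_wpM2l// Bmono//; lia.
Unshelve. all: by end_near. Qed.

(** * Tonelli's theorem on a triangle *)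

(** Tonelli for f(s) g(t) 1_A(s, t): the factor in the outer variable is constant in each inner
    integral. *)
Lemma fubini_tonelli_section (d1 d2 : measure_display)
    (T1 : measurableType d1) (T2 : measurableType d2) (R : realType)
    (m1 : {sigma_finite_measure set T1 -> \bar R})
    (m2 : {sigma_finite_measure set T2 -> \bar R})
    (A : set (T1 * T2)) (f : T1 -> R) (g : T2 -> R) :
  measurable A -> measurable_fun setT f -> measurable_fun setT g ->
  (forall s, 0 <= f s)%R -> (forall t, 0 <= g t)%R ->
  (\int[m1]_s ((f s)%:E * \int[m2]_(t in xsection A s) (g t)%:E) =
   \int[m2]_t ((g t)%:E * \int[m1]_(s in ysection A t) (f s)%:E))%E.
Proof.
move=> mA mf mg f0 g0.
pose h (st : T1 * T2) : \bar R := (f st.1 * g st.2 * \1_A st)%:E.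
have mh : measurable_fun [set: T1 * T2] h.
  apply/measurable_EFinP/measurable_funM; last exact: measurable_indic.
  by apply: measurable_funM; exact: measurableT_comp.
have h0 st : (0 <= h st)%E by rewrite lee_fin !mulr_ge0.
transitivity (\int[m1]_s \int[m2]_t h (s, t))%E;
    last rewrite (fubini_tonelli h mh h0).
- apply: eq_integral => s _.
  rewrite -ge0_integralZl_EFin//; last 3 first.
  - exact: measurable_xsection.
  - by move=> t _; rewrite lee_fin.
  - by apply/measurable_EFinP; exact: measurable_funS mg.
  rewrite [LHS]integral_mkcond; apply: eq_integral => t _.
  rewrite patchE mem_xsection /h/= indicE.
  by case: ((s, t) \in A); rewrite ?mulr1 ?mulr0 ?EFinM.
- apply: eq_integral => t _.
  rewrite -ge0_integralZl_EFin//; last 3 first.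
  - exact: measurable_ysection.
  - by move=> s _; rewrite lee_fin.
  - by apply/measurable_EFinP; exact: measurable_funS mf.
  rewrite [RHS]integral_mkcond; apply: eq_integral => s _.
  rewrite patchE mem_ysection /h/= indicE.
  by case: ((s, t) \in A); rewrite ?mulr1 ?mulr0 ?[(f s * g t)%R]mulrC ?EFinM.
Qed.

Section triangle.
Context (R : realType).
Variables (m1 m2 : {sigma_finite_measure set (measurableTypeR R) -> \bar R}).
Local Open Scope ereal_scope.

Lemma fubini_tonelli_triangle (f g : R -> R) (a b : R) :
  measurable_fun setT f -> measurable_fun setT g ->
  (forall t, 0 <= f t)%R -> (forall t, 0 <= g t)%R ->
  \int[m1]_(s in `[a, b]) ((f s)%:E * \int[m2]_(t in `[a, s]) (g t)%:E) =
  \int[m2]_(t in `[a, b]) ((g t)%:E * \int[m1]_(s in `[t, b]) (f s)%:E).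
Proof.
move=> mf mg f0 g0.
(* The sections of this triangle are [a, s] and [t, b] when the outer variable lies in [a, b], and
   empty otherwise. *)
pose A : set (R * R) := [set st | [&& a <= st.2, st.2 <= st.1 & st.1 <= b]%R].
have mA : measurable A.
  rewrite -[A]setTI; have : measurable_fun [set: R * R]
      (fun st => [&& a <= st.2, st.2 <= st.1 & st.1 <= b]%R).
    by apply: measurable_and; [|apply: measurable_and];
      exact: measurable_fun_ler.
  by move=> /(_ measurableT [set true]); apply.
have memA s t : ((s, t) \in A) = [&& a <= t, t <= s & s <= b]%R.
  by rewrite mem_setE.
have E := fubini_tonelli_section m1 m2 mA mf mg f0 g0.
rewrite integral_mkcond [RHS]integral_mkcond.
transitivity (\int[m1]_s ((f s)%:E * \int[m2]_(t in xsection A s) (g t)%:E));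
    last rewrite E.
- apply: eq_integral => s _; rewrite patchE mem_setE/= in_itv/=.
  case: ifPn => sab.
    congr (_ * _); congr (integral _ _ _); apply/seteqP; split => t;
      by rewrite /xsection/= memA in_itv/=; case/andP: sab => _ ->;
        rewrite andbT.
  rewrite (_ : xsection _ _ = set0) ?integral_set0 ?mule0//.
  apply/seteqP; split => t //; rewrite /xsection/= memA => /and3P[at_ ts sb].
  by rewrite (le_trans at_ ts) sb in sab.
- apply: eq_integral => t _; rewrite patchE mem_setE/= in_itv/=.
  case: ifPn => tab.
    congr (_ * _); congr (integral _ _ _); apply/seteqP; split => s;
      by rewrite /ysection/= memA in_itv/=; case/andP: tab => ->.
  rewrite (_ : ysection _ _ = set0) ?integral_set0 ?mule0//.
  apply/seteqP; split => s //; rewrite /ysection/= memA => /and3P[at_ ts sb].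
  by rewrite at_ (le_trans ts sb) in tab.
Qed.

End triangle.

(** * Primitives of nonnegative nondecreasing functions *)

Section primitive.
Context (R : realType).
Implicit Types f g : measurableTypeR R -> R.

(** For x < 0 the interval is empty and the value is 0, so nonnegativity and monotonicity pass to
    the primitive on the whole line. *)
Definition primitive (m : {measure set (measurableTypeR R) -> \bar R}) (f : R -> R)
    (x : R) : R :=
  \int[m]_(t in `[0, x]) f t.

Section any_measure.
Variables (m : {measure set (measurableTypeR R) -> \bar R}).
Hypothesis m_fin : forall x, (m `[0%R, x]%classic < +oo)%E.

(** Monotonicity is the regularity carried through the iterated integrals: it gives measurability
    and the bound |f a| + |f b| on [a, b]. *)
Lemma nondecreasing_integrable f a b : (0 <= a) -> nondecreasing f ->
  m.-integrable `[a, b] (EFin \o f).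
Proof.
move=> a0 fh; apply: measurable_bounded_integrable => //.
- apply: le_lt_trans (m_fin b); apply: le_measure; rewrite ?inE//.
  by apply: subset_itvr; rewrite bnd_simp.
- exact: nondecreasing_measurable.
- exists (`|f a| + `|f b|); split; first exact: num_real.
  move=> M HM t /=; rewrite in_itv/= => /andP[at_ tb].
  apply/ltW/(le_lt_trans _ HM).
  have := fh _ _ at_; have := fh _ _ tb.
  rewrite ler_norml; have := ler_norm (f b); have := ler_norm (- f a).
  rewrite normrN; have := normr_ge0 (f a); have := normr_ge0 (f b); lra.
Qed.

Lemma primitive_ge0 f : (forall t, 0 <= f t) -> forall x, 0 <= primitive m f x.
Proof. by move=> f0 x; exact: Rintegral_ge0. Qed.

Lemma primitiveE f x : nondecreasing f ->
  (\int[m]_(t in `[0%R, x]) (f t)%:E)%E = (primitive m f x)%:E.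
Proof.
move=> fh; rewrite fineK//; apply: integrable_fin_num => //.
exact: nondecreasing_integrable.
Qed.

Lemma primitive_nondecreasing f : (forall t, 0 <= f t) -> nondecreasing f ->
  nondecreasing (primitive m f).
Proof.
move=> f0 fh x y xy; rewrite -lee_fin -!primitiveE//.
apply: ge0_subset_integral => //.
- by apply/measurable_EFinP; exact: nondecreasing_measurable.
- by move=> t _; rewrite lee_fin.
- by apply: subset_itvl; rewrite bnd_simp.
Qed.

Lemma primitive_le f x : (m `[0%R, x]%classic <= 1)%E ->
  (forall t, 0 <= f t) -> nondecreasing f -> primitive m f x <= f x.
Proof.
move=> m1 f0 fh; rewrite -lee_fin -primitiveE//.
apply: (@le_trans _ _ (\int[m]_(t in `[0%R, x]) cst (f x)%:E t)%E).
  apply: ge0_le_integral => //.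
  - by move=> t _; rewrite lee_fin.
  - by apply/measurable_EFinP; exact: nondecreasing_measurable.
  - by move=> t /=; rewrite in_itv/= lee_fin => /andP[_ /fh].
by rewrite integral_cst//= -[leRHS]mule1; apply: lee_wpmul2l; rewrite ?lee_fin.
Qed.

End any_measure.

Notation lambda := (@lebesgue_measure R).

Lemma lebesgue_fin (x : R) : (lambda `[0%R, x]%classic < +oo)%E.
Proof. by rewrite lebesgue_measure_itv/=; case: ifP => _; rewrite ?ltry. Qed.

Lemma primitive_lebesgue_expR (L x : R) : 0 < L -> 0 <= x ->
  primitive lambda (fun t => expR (L * t)) x = (expR (L * x) - 1) / L.
Proof.
(* The fundamental theorem of calculus is applied on a nondegenerate interval, so x = 0 is treated
   apart. *)
move=> L0; rewrite le_eqVlt => /predU1P[<-|x0].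
  by rewrite /primitive set_itv1 Rintegral_set1 mulr0 expR0 subrr mul0r.
have dF (t : R) : is_derive t 1 (fun t => expR (L * t) / L) (expR (L * t)).
  have -> : (fun t => expR (L * t) / L) = (fun t => L^-1 *: expR (L * t)).
    by apply/funext => u; rewrite mulrC.
  apply: is_derive_eq.
  by rewrite /GRing.scale/=; field; rewrite gt_eqF.
have cF : continuous (fun t => expR (L * t) / L).
  by move=> t; apply: differentiable_continuous; apply/derivable1_diffP.
rewrite /primitive /Rintegral.
rewrite (@continuous_FTC2 _ _ (fun t => expR (L * t) / L))//=.
- by rewrite mulr0 expR0 -mulrBl.
- apply: continuous_subspaceT => t; apply: differentiable_continuous.
  exact/derivable1_diffP.
- split => //.
  + by apply: cvg_at_right_filter; exact: cF.
  + by apply: cvg_at_left_filter; exact: cF.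
- by move=> t _; rewrite derive1E derive_val.
Qed.

(** Against the weight exp(L x), each Lebesgue integration gains a factor 1 / L. *)
Lemma primitive_lebesgue_le_expR f (C L x : R) : 0 <= C -> 0 < L ->
  (forall t, 0 <= f t) -> nondecreasing f ->
  (forall t, 0 <= t -> f t <= C * expR (L * t)) ->
  0 <= x -> primitive lambda f x <= C / L * expR (L * x).
Proof.
move=> C0 L0 f0 fh fle x0.
have eh : nondecreasing (fun t => expR (L * t)).
  by move=> s t st; rewrite ler_expR ler_pM2l.
have eint : lambda.-integrable `[0, x] (EFin \o (fun t => expR (L * t))).
  exact: (nondecreasing_integrable lebesgue_fin).
apply: (@le_trans _ _ (\int[lambda]_(t in `[0, x]) (C * expR (L * t)))).
  apply: le_Rintegral => //.
  - exact: (nondecreasing_integrable lebesgue_fin).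
  - apply: (nondecreasing_integrable lebesgue_fin) => // s t st.
    by rewrite ler_wpM2l//; exact: eh.
  - by move=> t /=; rewrite in_itv/= => /andP[t0 _]; exact: fle.
rewrite RintegralZl// -/(primitive _ _ _) primitive_lebesgue_expR//.
by rewrite -mulrA ler_wpM2l// mulrC ler_wpM2l ?invr_ge0 ?gerBl// ltW.
Qed.

(* Swapping the order of integration produces the inner integral of [f] over
   [t, x]; it equals the difference of primitives because Lebesgue measure
   has no atoms. *)
Lemma primitive_by_parts
    (m : {sigma_finite_measure set (measurableTypeR R) -> \bar R}) f g x :
  (forall y, (m `[0%R, y]%classic < +oo)%E) ->
  (forall t, 0 <= f t) -> nondecreasing f ->
  (forall t, 0 <= g t) -> nondecreasing g ->
  primitive lambda f x * primitive m g x =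
  \int[m]_(t in `[0, x]) (primitive lambda f t * g t) +
  \int[lambda]_(t in `[0, x]) (f t * primitive m g t).
Proof.
move=> mfin f0 fh g0 gh.
have lfin := lebesgue_fin.
have mg := nondecreasing_integrable mfin x (lexx 0) gh.
have mFg :
    m.-integrable `[0, x] (EFin \o (fun t => primitive lambda f t * g t)).
  apply: (nondecreasing_integrable mfin) => // s t st.
  by rewrite ler_pM ?primitive_ge0 ?gh//; exact: (primitive_nondecreasing lfin).
(* With F the Lebesgue primitive of f, this integral becomes that of (F(x) - F(t)) g(t) against [m],
   and the terms in F(t) cancel. *)
have -> : \int[lambda]_(t in `[0, x]) (f t * primitive m g t) =
    \int[m]_(t in `[0, x])
      (primitive lambda f x * g t - primitive lambda f t * g t).
  rewrite /Rintegral; congr fine.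
  transitivity (\int[lambda]_(s in `[0%R, x])
      ((f s)%:E * \int[m]_(t in `[0%R, s]) (g t)%:E))%E.
    by apply: eq_integral => s _; rewrite primitiveE.
  rewrite fubini_tonelli_triangle//; last 2 first.
  - exact: nondecreasing_measurable.
  - exact: nondecreasing_measurable.
  apply: eq_integral => t; rewrite mem_setE/= in_itv/= => /andP[t0 tx].
  have fint := nondecreasing_integrable lfin x (lexx 0) fh.
  have fint' := nondecreasing_integrable lfin x t0 fh.
  rewrite -mulrBl (Rintegral_itvB fint) ?bnd_simp// EFinM muleC.
  congr (_ * _)%E.
  rewrite Rintegral_itv_obnd_cbnd; first by rewrite fineK// integrable_fin_num.
  by apply: integrableS fint' => //; apply: subset_itvr; rewrite bnd_simp.
rewrite RintegralB//; last first.
  apply: (nondecreasing_integrable mfin) => // s t st.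
  by rewrite ler_wpM2l ?primitive_ge0 ?gh.
by rewrite RintegralZl// addrC subrK.
Qed.

End primitive.

(** The even indices will carry the product of cosines, the odd ones that of sines. *)
Lemma sum_alternating (V : zmodType) (u : nat -> V) (n : nat) :
  \sum_(i < (2 * n).+1) (if odd i then - u i else u i) =
  \sum_(j < n.+1) u (2 * j)%N - \sum_(j < n) u (2 * j + 1)%N.
Proof.
elim: n => [|n IH]; first by rewrite big_ord0 !big_ord_recr !big_ord0/= subr0.
rewrite mulnS !addSn add0n big_ord_recr big_ord_recr/= IH.
rewrite [in RHS]big_ord_recr/= [X in _ = _ - X]big_ord_recr/=.
rewrite mul2n odd_double/= opprD addrACA -mul2n mulnS addrAC -!addrA.
by congr (_ + _); rewrite !addrA addn1 add2n.
Qed.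

(** * The iterated integrals and their growth *)

Section iterated_primitives.
Context (R : realType) (mu : probability (measurableTypeR R) R).
Notation lambda := (@lebesgue_measure R).
Notation p := (p mu).
Notation q := (q mu).

Let mu_fin x : (mu `[0%R, x]%classic < +oo)%E.
Proof. by apply: le_lt_trans (probability_le1 _ _) _; rewrite ?ltry. Qed.

Let lambda_fin := @lebesgue_fin R.

Lemma pS n :
  p n.+1 = if odd n then primitive lambda (p n) else primitive mu (p n).
Proof. by rewrite /=; case: odd. Qed.

Lemma qS n :
  q n.+1 = if odd n then primitive mu (q n) else primitive lambda (q n).
Proof. by rewrite /=; case: odd. Qed.

#[local] Arguments Defs.p : simpl never.
#[local] Arguments Defs.q : simpl never.

Lemma p_ge0 n x : 0 <= p n x.
Proof.
elim: n x => [|n IH] x; first exact: ler01.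
by rewrite pS; case: odd; apply: primitive_ge0.
Qed.

Lemma q_ge0 n x : 0 <= q n x.
Proof.
elim: n x => [|n IH] x; first exact: ler01.
by rewrite qS; case: odd; apply: primitive_ge0.
Qed.

Lemma p_nondecreasing n : nondecreasing (p n).
Proof.
elim: n => [x y _ //|n IH]; rewrite pS.
by case: odd; apply: primitive_nondecreasing => // t; exact: p_ge0.
Qed.

Lemma q_nondecreasing n : nondecreasing (q n).
Proof.
elim: n => [x y _ //|n IH]; rewrite qS.
by case: odd; apply: primitive_nondecreasing => // t; exact: q_ge0.
Qed.

(** The exponent counts the Lebesgue integrations among the n that build [p n]; those against [mu],
    of mass at most 1, preserve the bound. *)
Lemma p_le_expR (L x : R) n : 0 < L -> 0 <= x ->
  p n x <= L^-1 ^+ n./2 * expR (L * x).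
Proof.
move=> L0; elim: n x => [|n IH] x x0.
  by rewrite expr0 mul1r -[X in X <= _]/1 -expR0 ler_expR mulr_ge0// ltW.
have Ln : 0 <= L^-1 ^+ n./2 by rewrite exprn_ge0// invr_ge0 ltW.
rewrite pS [n.+1./2]/= uphalf_half; case: ifP => _.
  rewrite add1n exprSr.
  exact: (primitive_lebesgue_le_expR Ln L0 (p_ge0 n) (@p_nondecreasing n) IH).
apply: le_trans (IH _ x0).
apply: primitive_le => //; first exact: probability_le1.
  exact: p_ge0.
exact: p_nondecreasing.
Qed.

(** Here the first integration is against Lebesgue measure, so their number is rounded up. *)
Lemma q_le_expR (L x : R) n : 0 < L -> 0 <= x ->
  q n x <= L^-1 ^+ uphalf n * expR (L * x).
Proof.
move=> L0; elim: n x => [|n IH] x x0.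
  by rewrite expr0 mul1r -[X in X <= _]/1 -expR0 ler_expR mulr_ge0// ltW.
have Ln : 0 <= L^-1 ^+ uphalf n by rewrite exprn_ge0// invr_ge0 ltW.
rewrite qS [uphalf n.+1]/=; case: ifP => [on|en].
  have -> : n./2.+1 = uphalf n by rewrite uphalf_half on.
  apply: le_trans (IH _ x0).
  apply: primitive_le => //; first exact: probability_le1.
    exact: q_ge0.
  exact: q_nondecreasing.
have -> : n./2.+1 = (uphalf n).+1 by rewrite uphalf_half en.
rewrite exprSr.
exact: (primitive_lebesgue_le_expR Ln L0 (q_ge0 n) (@q_nondecreasing n) IH).
Qed.

(** * Telescoping of the alternating sum *)

(** The measure is the one that takes [q k] to [q k.+1]; for k + m odd it also takes [p m] to
    [p m.+1]. *)
Definition mixed (k m : nat) (x : R) : R :=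
  if odd k then \int[mu]_(t in `[0, x]) (q k t * p m t)
  else \int[lambda]_(t in `[0, x]) (q k t * p m t).

(* The parity condition makes [q k.+1] and [p m.+1] primitives with respect to
   different measures, one of which is Lebesgue measure. *)
Lemma qS_mul_pS k m x : ~~ odd (k + m) ->
  q k.+1 x * p m.+1 x = mixed k m.+1 x + mixed k.+1 m x.
Proof.
rewrite oddD /mixed/= => km.
case: ifP km => ok /=; rewrite ?negbK => om.
- rewrite qS ok pS om [LHS]mulrC primitive_by_parts;
    do ?[exact: mu_fin|exact: p_ge0|exact: q_ge0|exact: p_nondecreasing|
         exact: q_nondecreasing].
  by congr (_ + _); apply: eq_Rintegral => t _; rewrite mulrC ?pS ?om ?qS ?ok.
- rewrite qS ok pS (negbTE om) primitive_by_parts;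
    do ?[exact: mu_fin|exact: p_ge0|exact: q_ge0|exact: p_nondecreasing|
         exact: q_nondecreasing].
  rewrite addrC.
  by congr (_ + _); apply: eq_Rintegral => t _;
    rewrite ?pS ?qS ?(negbTE om) ?ok.
Qed.

(** The term i = 0 is the single integral [mixed 0 n x]; every later product is a sum of two
    consecutive mixed integrals, and the signs leave only the last one. *)
Lemma sum_alternating_qp_partial n k x : odd n -> (k <= n)%N ->
  \sum_(i < k.+1) (if odd i then - (q i x * p (n.+1 - i) x)
                   else q i x * p (n.+1 - i) x) =
  if odd k then - mixed k (n - k) x else mixed k (n - k) x.
Proof.
move=> on; elim: k => [|k IH] kn.
  rewrite big_ord_recr big_ord0/= add0r !subn0 -[q 0 x]/1 mul1r pS on.
  by apply: eq_Rintegral => t _; rewrite -[q 0 t]/1 mul1r.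
rewrite big_ord_recr IH 1?ltnW//= subSS.
have e : (n - k)%N = (n - k.+1).+1 by lia.
rewrite e qS_mul_pS; last by rewrite addnBA; lia.
by case: (odd k) => /=; rewrite ?addKr// opprD addrA subrr add0r.
Qed.

(** The final product, with factor [p 0], is the single integral [mixed n 0 x]; it cancels what the
    telescoping leaves, n being odd. *)
Lemma sum_alternating_qp n x : odd n ->
  \sum_(i < n.+2) (if odd i then - (q i x * p (n.+1 - i) x)
                   else q i x * p (n.+1 - i) x) = 0.
Proof.
move=> on; rewrite big_ord_recr sum_alternating_qp_partial//= on/= !subnn.
rewrite qS on /mixed on -[p 0 x]/1 mulr1.
rewrite (@eq_Rintegral _ _ _ mu _ (q n)) ?addNr// => t _.
by rewrite -[p 0 t]/1 mulr1.
Qed.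

(** * Absolute convergence of the four series *)

(** Comparison with a geometric series of ratio z^2 / L < 1. *)
Lemma cvg_normed_series_power (u : R^nat) (C L z : R) (e : nat) :
  (forall n, 0 <= u n <= C * L^-1 ^+ n) -> z ^+ 2 < L ->
  cvgn [normed series (fun n => (-1) ^+ n * z ^+ (2 * n + e) * u n)].
Proof.
move=> ule zL; have L0 : 0 < L by apply: le_lt_trans zL; exact: sqr_ge0.
apply: (@series_le_cvg _ _ (geometric (`|z| ^+ e * C) (z ^+ 2 / L))).
- by move=> n; exact: normr_ge0.
- move=> n; have /andP[un0 unC] := ule n.
  have C0 : 0 <= C.
    by have /andP[] := ule 0%N; rewrite expr0 mulr1; exact: le_trans.
  apply: geometric_ge0; first by rewrite mulr_ge0 ?exprn_ge0.
  by rewrite divr_ge0 ?sqr_ge0// ltW.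
- move=> n; have /andP[un0 unC] := ule n.
  rewrite /= !normrM normrX normrN1 expr1n mul1r normrX (ger0_norm un0).
  have -> : `|z| ^+ (2 * n + e) = `|z| ^+ e * (z ^+ 2) ^+ n.
    by rewrite exprD exprM real_normK ?num_real// mulrC.
  rewrite [(z ^+ 2 / L) ^+ n]exprMn -!mulrA ler_wpM2l ?exprn_ge0//.
  by rewrite [leRHS]mulrCA ler_wpM2l// exprn_ge0// sqr_ge0.
- apply: is_cvg_geometric_series.
  by rewrite ger0_norm ?divr_ge0 ?sqr_ge0 ?ltr_pdivrMr ?mul1r// ltW.
Qed.

Lemma cvg_normed_series_p (z x : R) (e : nat) : 0 <= x ->
  (e <= 1)%N ->
  cvgn [normed series
    (fun n => (-1) ^+ n * z ^+ (2 * n + e) * p (2 * n + e) x)].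
Proof.
(* The choice L = z^2 + 1 makes the ratio z^2 / L less than 1. *)
move=> x0 e1; have L0 : 0 < z ^+ 2 + 1 by rewrite ltr_wpDl ?sqr_ge0.
apply: (@cvg_normed_series_power _ (expR ((z ^+ 2 + 1) * x)) (z ^+ 2 + 1)).
  move=> n; rewrite p_ge0/= mulrC.
  have := p_le_expR (2 * n + e) L0 x0.
  by have -> : (2 * n + e)./2 = n by lia.
by rewrite ltrDl.
Qed.

Lemma cvg_normed_series_q (z x : R) (e : nat) : 0 <= x ->
  cvgn [normed series
    (fun n => (-1) ^+ n * z ^+ (2 * n + e) * q (2 * n + e) x)].
Proof.
move=> x0; have L0 : 0 < z ^+ 2 + 1 by rewrite ltr_wpDl ?sqr_ge0.
(* The factor 1 / L that [q] gains at odd indices is absorbed into the constant. *)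
set C := (z ^+ 2 + 1)^-1 ^+ uphalf e * expR ((z ^+ 2 + 1) * x).
apply: (@cvg_normed_series_power _ C (z ^+ 2 + 1)).
  move=> n; rewrite q_ge0/= /C mulrAC -exprD.
  have := q_le_expR (2 * n + e) L0 x0.
  by have -> : uphalf (2 * n + e) = (uphalf e + n)%N
    by rewrite !uphalf_half; lia.
by rewrite ltrDl.
Qed.

(** * Comparison of coefficients and conclusion *)

(** Two sine terms carry an extra z^2, so order n of their product meets order n + 1 of the cosine
    product, with opposite sign. *)
Lemma cauchy_prod_cos_sin (z x : R) (n : nat) :
  cauchy_prod (fun n => (-1) ^+ n * z ^+ (2 * n) * q (2 * n) x)
              (fun n => (-1) ^+ n * z ^+ (2 * n) * p (2 * n) x) n.+1 +
  cauchy_prod (fun n => (-1) ^+ n * z ^+ (2 * n + 1) * q (2 * n + 1) x)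
              (fun n => (-1) ^+ n * z ^+ (2 * n + 1) * p (2 * n + 1) x) n = 0.
Proof.
pose u i := q i x * p (2 * n.+1 - i) x.
have -> : cauchy_prod (fun n => (-1) ^+ n * z ^+ (2 * n) * q (2 * n) x)
    (fun n => (-1) ^+ n * z ^+ (2 * n) * p (2 * n) x) n.+1 =
    (-1) ^+ n.+1 * z ^+ (2 * n.+1) * \sum_(j < n.+2) u (2 * j)%N.
  rewrite /cauchy_prod mulr_sumr; apply: eq_bigr => -[j /= jn] _.
  rewrite /u -mulnBr.
  have -> : (2 * n.+1 = 2 * j + 2 * (n.+1 - j))%N by lia.
  have -> : (-1 : R) ^+ n.+1 = (-1) ^+ j * (-1) ^+ (n.+1 - j).
    by rewrite -exprD subnKC.
  rewrite !exprD; ring.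
have -> : cauchy_prod (fun n => (-1) ^+ n * z ^+ (2 * n + 1) * q (2 * n + 1) x)
    (fun n => (-1) ^+ n * z ^+ (2 * n + 1) * p (2 * n + 1) x) n =
    - ((-1) ^+ n.+1 * z ^+ (2 * n.+1) * \sum_(j < n.+1) u (2 * j + 1)%N).
  rewrite /cauchy_prod mulr_sumr -sumrN; apply: eq_bigr => -[j /= jn] _.
  have -> : u (2 * j + 1)%N = q (2 * j + 1) x * p (2 * (n - j) + 1) x.
    by rewrite /u; congr (_ * p _ x); lia.
  have -> : (2 * n.+1 = (2 * j + 1) + (2 * (n - j) + 1))%N by lia.
  have -> : (n.+1 = j + (n - j) + 1)%N by lia.
  rewrite !exprD; ring.
rewrite -mulrBr -sum_alternating (_ : \sum_(i < _) _ = 0) ?mulr0//.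
have o : odd (2 * n).+1 by lia.
have e : (2 * n.+1 = (2 * n).+2)%N by lia.
by have := sum_alternating_qp x o; rewrite -e.
Qed.

End iterated_primitives.

(* A Borel probability measure on [0, 1] is a probability measure on the Borel
   sets of R that gives mass 1 to [0, 1]. *)
Theorem theorem5p3 (R : realType) (mu : probability (measurableTypeR R) R)
    (mu01 : mu [set` `[0 : R, 1 : R]] = 1%E) (mu_na : non_atomic mu)
    (x z : R) (x0 : 0 <= x) (x1 : x <= 1) :
  c_mu_lambda mu z x * c_lambda_mu mu z x
  + s_lambda_mu mu z x * s_mu_lambda mu z x = 1.
Proof.
have even0 (u : R^nat) :
    (fun n => (-1) ^+ n * z ^+ (2 * n + 0) * u (2 * n + 0)%N) =
    (fun n => (-1) ^+ n * z ^+ (2 * n) * u (2 * n)%N).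
  by apply/funext => n; rewrite addn0.
have := @cvg_normed_series_q R mu z x 0 x0.
rewrite (even0 (q mu ^~ x)) => q0.
have := @cvg_normed_series_p R mu z x 0 x0 isT.
rewrite (even0 (p mu ^~ x)) => p0.
have cc := cvg_series_cauchy_prod q0 p0.
have ss := cvg_series_cauchy_prod (@cvg_normed_series_q R mu z x 1 x0)
  (@cvg_normed_series_p R mu z x 1 x0 isT).
set c := cauchy_prod _ _ in cc; set s := cauchy_prod _ _ in ss.
(* The shift by one aligns the orders and sets apart the constant term [q 0 x * p 0 x], equal to
   1. *)
have cc1 : (fun n => series c n.+1) @ \oo -->
    c_mu_lambda mu z x * c_lambda_mu mu z x.
  by rewrite (@cvg_shiftS _ (series c)).
have cs1 n : series c n.+1 + series s n = 1.
  rewrite /series/= big_nat_recl// -addrA -big_split/= big1 ?addr0.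
    by rewrite /c /cauchy_prod big_ord1 /= !muln0 !expr0 !mul1r.
  by move=> i _; exact: cauchy_prod_cos_sin.
have lim1 : (fun n => series c n.+1 + series s n) @ \oo -->
    c_mu_lambda mu z x * c_lambda_mu mu z x +
    s_lambda_mu mu z x * s_mu_lambda mu z x.
  exact: cvgD cc1 ss.
rewrite (funext cs1) in lim1.
exact: (cvg_unique _ lim1 (cvg_cst _)).
Qed.
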